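(* Let $\varepsilon>0$. There is a constant $c_2>0$ depending only on $\varepsilon$ with the following property. Let $N,Q\ge 1$ be real, let $0\le M\le Q$, let $(a_n)$ be a sequence of complex numbers, and put $S(\alpha):=\sum_{n\le N}a_ne(n\alpha)$, $Z:=\sum_{n\le N}|a_n|^2$, where $e(x)=e^{2\pi i x}$. Let ${\cal S}\subset(M,M+Q]$ be a set of positive integers, $S:=|{\cal S}|$, and for $t\in\mathbb{N}$ let ${\cal S}_t:=\{q\in\mathbb{N}:tq\in{\cal S}\}$, $S_t:=|{\cal S}_t|$. For real $u\ge 0$, $k\in\mathbb{N}$, $l\in\mathbb{Z}$ with $\gcd(k,l)=1$ let $$A_t(u,k,l):=\max_{M/t\le y\le (M+Q)/t}\left|\{q\in{\cal S}_t\cap(y,y+u]:\ q\equiv l\bmod k\}\right|.$$ Let $X\ge 1$ and suppose that $$A_t(u,k,l)\le\left(1+\frac{S_t/k}{Q/t}\cdot u\right)X$$ holds for all positive integers $t,k$, integers $l$ and reals $u$ with $t\le\sqrt N$, $k\le \sqrt N/t$, $\gcd(k,l)=1$ and $kQ/\sqrt N\le u\le Q/t$. Then $$\sum_{q\in{\cal S}}\ \sum_{\substack{a=1\\ \gcd(a,q)=1}}^{q}\left|S\!\left(\frac aq\right)\right|^2\le c_2\left(N+QXN^{\varepsilon}\left(\sqrt N+S\right)\right)Z.$$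
   Context: $e(x)=e^{2\pi i x}$. *)

(* Defs.v *)
From HB Require Import structures.
From mathcomp Require Import all_boot all_order all_algebra finmap complex.
From mathcomp Require Import all_classical all_reals all_analysis.
Set Implicit Arguments.
Unset Strict Implicit.
Unset Printing Implicit Defensive.
Import Order.TTheory GRing.Theory Num.Theory.
Local Open Scope fset_scope.
Local Open Scope classical_set_scope.
Local Open Scope ring_scope.

(* e(x) = exp(2 pi i x), written through its real and imaginary parts. *)
Definition e {R : realType} (x : R) : R[i] :=
  (cos (2 * pi * x) +i* sin (2 * pi * x))%C.

Notation cnorm := ComplexField.Normc.normc.

(* For N >= 0 the naturals 1 <= n <= N are those with n < (truncn N).+1,
   since truncn N is then the integer part of N. *)
Definition expsum {R : realType} (N : R) (a : nat -> R[i]) (alpha : R) : R[i] :=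
  \sum_(1 <= n < (Num.truncn N).+1) a n * e (n%:R * alpha).

Definition sqnorm {R : realType} (N : R) (a : nat -> R[i]) : R :=
  \sum_(1 <= n < (Num.truncn N).+1) cnorm (a n) ^+ 2.

(* The set of q with t q in S, for t > 0; see in_dilated. *)
Definition dilated (S : {fset nat}) (t : nat) : {fset nat} :=
  [fset (q %/ t)%N | q in S & (t %| q)%N].

Lemma in_dilated (S : {fset nat}) (t q : nat) :
  (0 < t)%N -> (q \in dilated S t) = ((t * q)%N \in S).
Proof.
move=> t0; apply/imfsetP/idP => [[p /=]|tqS].
  by rewrite !inE => /andP[pS tp] ->; rewrite mulnC divnK.
by exists (t * q)%N; rewrite /= ?inE ?tqS ?dvdn_mulr // mulKn.
Qed.

Definition count_ap {R : realType} (S : {fset nat}) (t : nat) (u : R)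
    (k : nat) (l : int) (y : R) : nat :=
  #|` [fset q in dilated S t | (y < q%:R <= y + u)
                               && (q%:Z == l %[mod k%:Z])%Z] |.

(* The supremum is a maximum: see maxcount_attained and maxcount_ub. *)
Definition maxcount {R : realType} (M Q : R) (S : {fset nat}) (t : nat) (u : R)
    (k : nat) (l : int) : R :=
  sup [set (count_ap S t u k l y)%:R | y in `[M / t%:R, (M + Q) / t%:R]].

Lemma count_ap_le {R : realType} (S : {fset nat}) (t : nat) (u : R)
    (k : nat) (l : int) (y : R) : (count_ap S t u k l y <= #|` dilated S t|)%N.
Proof. by apply: fsubset_leq_card; apply/fsubsetP => q; rewrite !inE => /andP[]. Qed.

Lemma maxcount_ub {R : realType} (M Q : R) (S : {fset nat}) (t : nat) (u : R)
    (k : nat) (l : int) (y : R) :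
  M / t%:R <= y <= (M + Q) / t%:R ->
  (count_ap S t u k l y)%:R <= maxcount M Q S t u k l.
Proof.
move=> yI; apply: ub_le_sup; last by exists y => //=; rewrite in_itv.
by exists (#|` dilated S t|%:R) => _ [z _ <-]; rewrite ler_nat count_ap_le.
Qed.

Lemma maxcount_attained {R : realType} (M Q : R) (S : {fset nat}) (t : nat)
    (u : R) (k : nat) (l : int) :
  0 <= Q ->
  exists2 y, M / t%:R <= y <= (M + Q) / t%:R
           & maxcount M Q S t u k l = (count_ap S t u k l y)%:R.
Proof.
move=> Q0.
pose P m := `[< exists2 y : R, M / t%:R <= y <= (M + Q) / t%:R
                            & count_ap S t u k l y = m >].
have exP : exists m, P m.
  exists (count_ap S t u k l (M / t%:R)); apply/asboolP; exists (M / t%:R) => //.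
  by rewrite lexx ler_wpM2r ?invr_ge0 ?ler0n ?lerDl.
have ubP m : P m -> (m <= #|` dilated S t|)%N.
  by move=> /asboolP[y _ <-]; exact: count_ap_le.
case: (ex_maxnP exP ubP) => m /asboolP[y yI <-] maxm.
exists y => //; apply/eqP; rewrite eq_le maxcount_ub // andbT.
apply: ge_sup; first by exists (count_ap S t u k l y)%:R, y => //=; rewrite in_itv.
move=> _ [z /= zI <-]; rewrite in_itv /= in zI.
by rewrite ler_nat maxm //; apply/asboolP; exists z.
Qed.

(* Main.v *)
(* By the large sieve it is enough to bound, uniformly in x, the number of
   reduced fractions a/q with q in S and |x - a/q| <= 1/N.  By Dirichlet
   x = b0/r + z with r <= sqrt N and |z| <= 1/(r sqrt N).  A fraction a/q near x
   yields the integer m = a r - b0 q: m = 0 only happens for a/q = b0/r, and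
   otherwise |m| <= 4 Q r z' with z' = max(|z|, 1/N).  For given m let
   t = gcd(m, r); then t divides q, and q/t lies in a fixed reduced residue
   class modulo r/t and in an interval of length 4u, u = Q/(N z' t), so the
   hypothesis on A_t applies.  Summing over m, the gcd's contribute a divisor
   function, which is O(N^eps). *)
Require Import Defs.
From mathcomp Require Import all_boot all_order all_algebra finmap complex.
From mathcomp Require Import all_classical all_reals all_analysis.
From mathcomp Require Import ring lra zify.
Import Order.TTheory GRing.Theory Num.Theory.
Import numFieldNormedType.Exports.
Local Open Scope fset_scope.
Local Open Scope ring_scope.

(** * Duality and the large sieve inequality for unimodular points *)

Lemma sqr_norm_sum (C : numClosedFieldType) (I : Type) (s : seq I) (F : I -> C) :
  `|\sum_(i <- s) F i| ^+ 2 = \sum_(i <- s) \sum_(j <- s) F i * (F j)^*.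
Proof.
rewrite normCK rmorph_sum mulr_suml; apply: eq_bigr => i _.
by rewrite mulr_sumr.
Qed.

Lemma norm_mul_le_mean (C : numDomainType) (x y : C) :
  x \is Num.real -> y \is Num.real -> x * y *+ 2 <= x ^+ 2 + y ^+ 2.
Proof.
by move=> xr yr; rewrite -subr_ge0 addrAC -sqrrB real_exprn_even_ge0 // rpredB.
Qed.

(* Each n in [1, N] is a difference j - k of j, k in [0, 2N) in at least N ways,
   while the sum over all pairs (j, k) factors into squared geometric sums. *)
Lemma dual_large_sieve (C : numClosedFieldType) (I : Type) (s : seq I)
    (z : I -> C) (c : I -> C) (N : nat) (B : C) :
  (forall i, `|z i| = 1) ->
  (forall i, \sum_(j <- s) `|\sum_(k < N.*2) (z i * (z j)^*) ^+ k| ^+ 2 <= B) ->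
  N%:R * \sum_(1 <= n < N.+1) `|\sum_(i <- s) c i * z i ^+ n| ^+ 2
    <= B * \sum_(i <- s) `|c i| ^+ 2.
Proof.
move=> z1 hB.
pose D i j : C := `|\sum_(k < N.*2) (z i * (z j)^*) ^+ k| ^+ 2.
have D0 i j : 0 <= D i j by rewrite exprn_ge0.
have Dsym i j : D i j = D j i.
  rewrite /D -norm_conjC rmorph_sum; congr (`|_| ^+ 2); apply: eq_bigr => k _.
  by rewrite rmorphXn rmorphM /= conjCK mulrC.
pose T (j k : nat) : C := `|\sum_(i <- s) c i * z i ^+ j * (z i)^* ^+ k| ^+ 2.
have T0 j k : 0 <= T j k by rewrite exprn_ge0.
have Tshift n k : T (n + k)%N k = `|\sum_(i <- s) c i * z i ^+ n| ^+ 2.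
  congr (`|_| ^+ 2); apply: eq_bigr => i _.
  by rewrite exprD -!mulrA -exprMn -normCK z1 expr1n expr1n mulr1.
have lower : N%:R * \sum_(1 <= n < N.+1) `|\sum_(i <- s) c i * z i ^+ n| ^+ 2
    <= \sum_(0 <= k < N.*2) \sum_(0 <= j < N.*2) T j k.
  have N2 : (N <= N.*2)%N by rewrite -addnn leq_addr.
  rewrite (big_cat_nat _ N2) //=.
  rewrite -[leLHS]addr0; apply: lerD; last by apply: sumr_ge0 => k _; apply: sumr_ge0.
  rewrite mulr_natl -[X in _ *+ X]subn0 -sumr_const_nat.
  apply: ler_sum_nat => k kN.
  have h1 : (1 + k <= N.*2)%N by exact: leq_trans N2.
  have h2 : (N.+1 + k <= N.*2)%N by rewrite -addnn addSn -addnS leq_add2l.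
  rewrite (big_cat_nat _ h1) //=.
  rewrite [X in _ + X](big_cat_nat _ h2) //=; last by rewrite leq_add2r.
  rewrite -[leLHS]add0r; apply: lerD; first exact: sumr_ge0.
  rewrite -[leLHS]addr0; apply: lerD; last exact: sumr_ge0.
  rewrite big_addn addnK; apply: ler_sum => n _.
  by rewrite Tshift.
apply: le_trans lower _.
have T_D : \sum_(0 <= k < N.*2) \sum_(0 <= j < N.*2) T j k
    = \sum_(i <- s) \sum_(i' <- s) c i * (c i')^* * D i i'.
  under eq_bigr => k _ do under eq_bigr => j _ do rewrite /T sqr_norm_sum.
  under eq_bigr => k _ do rewrite exchange_big.
  rewrite exchange_big; apply: eq_bigr => i _.
  under eq_bigr => k _ do rewrite exchange_big.
  rewrite exchange_big; apply: eq_bigr => i' _.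
  rewrite /D -(big_mkord xpredT (fun k => (z i * (z i')^*) ^+ k)) sqr_norm_sum.
  rewrite exchange_big mulr_sumr; apply: eq_bigr => j _ /=.
  rewrite mulr_sumr; apply: eq_bigr => k _.
  rewrite !rmorphM /= !rmorphXn /= !rmorphM /= conjCK !exprMn; ring.
have sumD : \sum_(i <- s) \sum_(i' <- s) `|c i| ^+ 2 * D i i'
    <= B * \sum_(i <- s) `|c i| ^+ 2.
  rewrite mulr_sumr; apply: ler_sum => i _; rewrite -mulr_sumr mulrC.
  by apply: ler_wpM2r; rewrite ?exprn_ge0 //; exact: hB.
have T_ge0 : 0 <= \sum_(0 <= k < N.*2) \sum_(0 <= j < N.*2) T j k.
  by apply: sumr_ge0 => k _; apply: sumr_ge0.
(* Both sides are doubled so that 2 |c_i c_i'| can be replaced by |c_i|^2 + |c_i'|^2. By the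
   symmetry of [D], each of the two resulting sums is controlled by the row sums of [D]. *)
rewrite -(ger0_norm T_ge0) T_D -(ler_pMn2r (ltn0Sn 1)).
have sumD' : \sum_(i <- s) \sum_(i' <- s) `|c i'| ^+ 2 * D i i'
    <= B * \sum_(i <- s) `|c i| ^+ 2.
  rewrite exchange_big; apply: le_trans sumD.
  by apply: ler_sum => i _; apply: ler_sum => j _; rewrite Dsym.
rewrite [leRHS]mulr2n; apply: le_trans (lerD sumD sumD').
rewrite -big_split /=; under [leRHS]eq_bigr => i _ do rewrite -big_split /=.
apply: le_trans (ler_wMn2r 2 (ler_norm_sum _ _ _)) _.
rewrite -sumrMnl; apply: ler_sum => i _.
apply: le_trans (ler_wMn2r 2 (ler_norm_sum _ _ _)) _.
rewrite -sumrMnl; apply: ler_sum => i' _.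
rewrite normrM normrM norm_conjC (ger0_norm (D0 i i')) -mulrnAl -mulrDl.
by rewrite ler_wpM2r // norm_mul_le_mean ?normr_real.
Qed.


Lemma large_sieve (C : numClosedFieldType) (I : Type) (s : seq I)
    (z : I -> C) (a : nat -> C) (N : nat) (B : C) :
  (0 < N)%N -> 0 < B -> (forall i, `|z i| = 1) ->
  (forall i, \sum_(j <- s) `|\sum_(k < N.*2) (z i * (z j)^*) ^+ k| ^+ 2 <= B) ->
  \sum_(i <- s) `|\sum_(1 <= n < N.+1) a n * z i ^+ n| ^+ 2
    <= B / N%:R * \sum_(1 <= n < N.+1) `|a n| ^+ 2.
Proof.
move=> N0 B0 z1 hB.
(* Duality: V = sum_n a_n (sum_i c_i z_i^n), then AM-GM with weight B / N. *)
pose c i := (\sum_(1 <= n < N.+1) a n * z i ^+ n)^*.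
set V := leLHS; set Z := \sum_(1 <= n < _) `|a n| ^+ 2.
pose U : C := \sum_(1 <= n < N.+1) `|\sum_(i <- s) c i * z i ^+ n| ^+ 2.
have dual : N%:R * U <= B * V.
  have -> : V = \sum_(i <- s) `|c i| ^+ 2 by under [RHS]eq_bigr do rewrite norm_conjC.
  exact: dual_large_sieve.
have NC0 : 0 < N%:R :> C by rewrite ltr0n.
have l0 : 0 < B / N%:R by rewrite divr_gt0.
have V0 : 0 <= V by apply: sumr_ge0 => i _; rewrite exprn_ge0.
have VE : V = \sum_(1 <= n < N.+1) a n * \sum_(i <- s) c i * z i ^+ n.
  under [RHS]eq_bigr do rewrite mulr_sumr.
  rewrite [RHS]exchange_big; apply: eq_bigr => i _ /=.
  rewrite normCK mulr_suml; apply: eq_bigr => n _; rewrite /c; ring.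
have main : B / N%:R * V *+ 2 <= (B / N%:R) ^+ 2 * Z + U.
  rewrite -(ger0_norm V0) VE -mulrnAr.
  apply: le_trans (ler_wpM2l (ltW l0) (ler_wMn2r 2 (ler_norm_sum _ _ _))) _.
  rewrite -sumrMnl !mulr_sumr -big_split; apply: ler_sum => n _ /=.
  rewrite normrM -mulrnAr mulrA mulrnAr -exprMn.
  by rewrite norm_mul_le_mean ?normr_real // rpredM ?normr_real // gtr0_real.
(* By [dual], [U] is at most (B / N) V, which absorbs one of the two copies on the left of
   [main]. *)
have : B / N%:R * V <= (B / N%:R) ^+ 2 * Z.
  move: main; rewrite mulr2n -lerBrDr => /le_trans; apply.
  rewrite lerBlDr lerD2l -(ler_pM2l NC0).
  by rewrite !mulrA [N%:R * B]mulrC mulfK // gt_eqF.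
by rewrite expr2 -[_ * _ * Z]mulrA (ler_pM2l l0).
Qed.

(** * The additive character e(x) and its geometric sums *)

Lemma norm_normc (R : realType) (z : R[i]) : `|z| = (cnorm z)%:C%C.
Proof. by []. Qed.

Lemma normc_ge0 (R : realType) (z : R[i]) : 0 <= cnorm z.
Proof. by case: z => x y; exact: sqrtr_ge0. Qed.

Lemma eD (R : realType) (x y : R) : e (x + y) = e x * e y.
Proof.
rewrite /e mulrDr cosD sinD; simpc.
by congr (_ +i* _)%C; rewrite addrC [X in _ + X]mulrC.
Qed.

Lemma e0 (R : realType) : e 0 = 1 :> R[i].
Proof. by rewrite /e mulr0 cos0 sin0. Qed.

Lemma eN (R : realType) (x : R) : e (- x) = (e x)^*.
Proof. by rewrite /e mulrN cosN sinN. Qed.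

Lemma norm_e (R : realType) (x : R) : `|e x| = 1.
Proof. by rewrite /e normc_def /= cos2Dsin2 sqrtr1. Qed.

Lemma eMn (R : realType) (n : nat) (x : R) : e (n%:R * x) = e x ^+ n.
Proof.
elim: n => [|n IH]; first by rewrite mul0r e0.
by rewrite -natr1 mulrDl mul1r eD IH exprSr.
Qed.

Lemma e1 (R : realType) : e 1 = 1 :> R[i].
Proof. by rewrite /e mulr1 mulr_natl cos2pi sin2pi. Qed.

Lemma eDint (R : realType) (x : R) (m : int) : e (x + m%:~R) = e x.
Proof.
suff em : e m%:~R = 1 :> R[i] by rewrite eD em mulr1.
have en n : e n%:R = 1 :> R[i] by rewrite -[n%:R]mulr1 eMn e1 expr1n.
by case: m => n; [exact: en | rewrite NegzE mulrNz eN en conjC1].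
Qed.

Lemma sin_ge_half (R : realType) (x : R) :
  0 <= x <= pi / 2 -> x / 2 <= sin x.
Proof.
move=> /andP[x0 xpi]; have pi0 := pi_gt0 R.
have -> : x = x / 2 *+ 2 by rewrite mulr2n; field.
set y := x / 2.
have y0 : 0 <= y by rewrite divr_ge0.
have ypi : y <= pi / 4 by rewrite /y; lra.
have cos_y (t : R) : 0 <= t <= pi / 4 -> cos (pi / 4) <= cos t.
  case/andP=> t0 tpi; case: (eqVneq t (pi / 4)) => [-> // | tn].
  rewrite ltW // ltr_cos ?in_itv /= ?lt_neqAle ?tn ?tpi //; apply/andP; split; lra.
have c0 : 0 <= cos (pi / 4) :> R by rewrite cos_ge0_pihalf //; apply/andP; split; lra.
have cc : cos (pi / 4) ^+ 2 *+ 2 = 1 :> R.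
  apply/eqP; rewrite -subr_eq0 -cos_mulr2n; apply/eqP.
  by rewrite -[RHS](cos_pihalf R); congr cos; rewrite mulr2n; field.
(* sin x = 2 sin y cos y with y = x / 2 <= pi / 4, where cos y >= 1 / sqrt 2. *)
have siny : y * cos (pi / 4) <= sin y.
  have [t tI sy] : exists2 t, t \in `[0, y] & sin y - sin 0 = cos t * (y - 0).
    apply: (@MVT_segment _ sin cos) => //.
    by apply: continuous_subspaceT => u; exact: continuous_sin.
  move: sy; rewrite sin0 !subr0 => ->; rewrite mulrC ler_wpM2r // cos_y //.
  by move: tI; rewrite in_itv /= => /andP[-> /le_trans]; apply.
have cosy : cos (pi / 4) <= cos y by rewrite cos_y ?y0.
rewrite sin_mulr2n.
have : y * cos (pi / 4) * cos (pi / 4) <= sin y * cos y.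
  by rewrite ler_pM // mulr_ge0.
have -> : y * cos (pi / 4) * cos (pi / 4) = y / 2.
  by rewrite -mulrA -expr2; congr (_ * _); move: cc; rewrite mulr2n; lra.
rewrite [cos y * _]mulrC !mulr2n; lra.
Qed.

(** The modulus of 1 - e(x) is 2 sin(pi |x|), and sin(pi |x|) >= pi |x| / 2 >= |x| because pi >= 2.
    The comparison is made between squares, under the square root. *)
Lemma normc_1Be (R : realType) (x : R) :
  `|x| <= 1 / 2 -> 2 * `|x| <= cnorm (1 - e x).
Proof.
move=> x2; have pi2 := pi_ge2 R.
have x0 : 0 <= 2 * `|x| by rewrite mulr_ge0.
rewrite -(ger0_norm x0) -sqrtr_sqr /=; apply: ler_wsqrtr.
have sx : (pi * `|x|) / 2 <= sin (pi * `|x|).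
  apply: sin_ge_half; rewrite mulr_ge0 ?pi_ge0 //= ler_pM2l ?pi_gt0 //.
  by rewrite -[X in _ <= X]mul1r.
rewrite sub0r sqrrN sin2cos2.
have -> : cos (2 * pi * x) = 1 - sin (pi * `|x|) ^+ 2 *+ 2.
  rewrite -cos_norm !normrM (ger0_norm (pi_ge0 R)) ger0_norm //.
  rewrite -mulrA mulr_natl cos_mulr2n cos2sin2; ring.
have : `|x| <= sin (pi * `|x|).
  apply: le_trans sx; have := normr_ge0 x; nra.
have := normr_ge0 x; nra.
Qed.

Lemma normc_geometric_le (R : realType) (x : R) (n : nat) :
  cnorm (\sum_(k < n) e x ^+ k) <= n%:R.
Proof.
rewrite -lecR -norm_normc (le_trans (ler_norm_sum _ _ _)) //.
under eq_bigr do rewrite normrX norm_e expr1n.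
by rewrite sumr_const card_ord rmorph_nat.
Qed.

(** Multiplied by 1 - e(x), the sum telescopes to 1 - e(nx), of modulus at most 2, while 2 |x| <= |1
    - e(x)|. The product form also covers x = 0. *)
Lemma normc_geometric_decay (R : realType) (x : R) (n : nat) :
  `|x| <= 1 / 2 -> `|x| * cnorm (\sum_(k < n) e x ^+ k) <= 1.
Proof.
move=> /normc_1Be lex; rewrite -(ler_pM2l (ltr0Sn R 1)) mulr1 mulrA.
apply: (le_trans (ler_wpM2r _ lex)); first exact: normc_ge0.
rewrite -ComplexField.Normc.normcM -opprB mulNr -subrX1 -lecR -norm_normc normrN.
rewrite (le_trans (ler_normB _ _)) // normrX norm_e expr1n normr1.
by rewrite rmorph_nat.
Qed.

(** * The large sieve for points with a bounded number in each short interval *)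

(** Telescoping: 1 / t - 1 / (t + 1) exceeds 1 / (t + 1)^2 by exactly 1 / (t (t + 1)^2). The
    subtracted term carries the induction. *)
Lemma sum_inv_sqr_le (R : realFieldType) (n : nat) :
  \sum_(1 <= m < n.+2) (m%:R ^+ 2)^-1 <= 2 - n.+1%:R^-1 :> R.
Proof.
elim: n => [|n IH]; first by rewrite big_nat1 expr1n invr1; lra.
rewrite big_nat_recr //= (le_trans (lerD IH (lexx _))) //.
have E : n.+2%:R = n.+1%:R + 1 :> R by rewrite natr1.
have n0 : 0 < n.+1%:R :> R by rewrite ltr0n.
rewrite {}E; move: (n.+1%:R) n0 => t t0.
rewrite -subr_ge0.
have -> : 2 - (t + 1)^-1 - (2 - t^-1 + ((t + 1) ^+ 2)^-1)
   = (t * (t + 1) ^+ 2)^-1 :> R by field; rewrite !gt_eqF //; lra.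
by rewrite invr_ge0 mulr_ge0 ?ltW // exprn_gt0 //; lra.
Qed.

Definition near_int {R : realType} (d x : R) : bool :=
  `[< exists m : int, `|x - m%:~R| <= d >].

Lemma sum_geometric_le (R : realType) (I : Type) (s : seq I) (alpha : I -> R)
    (n : nat) (K : R) :
  (0 < n)%N ->
  (forall b, (count (fun i => near_int (2 * n%:R)^-1 (b - alpha i)) s)%:R <= K) ->
  forall b, \sum_(i <- s) cnorm (\sum_(k < n.*2) e (b - alpha i) ^+ k) ^+ 2
    <= 12 * n%:R ^+ 2 * K.
Proof.
move=> n0 hK b; have nR : 0 < n%:R :> R by rewrite ltr0n.
(* Bin the points by m = floor (n ||b - alpha i||): each bin is covered by two
   intervals of length 1 / n, and the kernel is O(n / m) on it. *)
pose th i := b - alpha i - (Num.floor (b - alpha i + 1 / 2))%:~R.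
have th2 i : `|th i| <= 1 / 2.
  have /andP[fl fu] := Num.Theory.floor_itv (b - alpha i + 1 / 2).
  rewrite ler_norml /th; move: fl fu; rewrite intrD.
  by move: (_%:~R) => f ? ?; apply/andP; split; lra.
have eth i : e (b - alpha i) = e (th i) by rewrite /th -mulrNz eDint.
pose mu i := Num.truncn (n%:R * `|th i|).
have muP i : (mu i)%:R <= n%:R * `|th i| < (mu i).+1%:R.
  by apply: Num.Theory.truncn_itv; rewrite mulr_ge0.
(* Bounds for the squared kernel in units of n^2: counting the 2n terms gives (2n)^2 in bin 0, and
   the decay of the geometric sum gives (n / m)^2 in bin m > 0. *)
pose w m : R := if m is 0%N then 4 else (m%:R ^+ 2)^-1.
have w0 m : 0 <= w m by case: m => [|m] //=; rewrite invr_ge0 exprn_ge0.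
have Gw i : cnorm (\sum_(k < n.*2) e (b - alpha i) ^+ k) ^+ 2
    <= n%:R ^+ 2 * w (mu i).
  rewrite eth; have := muP i; case: (mu i) => [|m] /andP[lo up].
    have -> : n%:R ^+ 2 * w 0%N = (n.*2%:R) ^+ 2 by rewrite /w -mul2n natrM; ring.
    rewrite lerXn2r ?nnegrE ?normc_ge0 //.
    exact: normc_geometric_le.
  have m0 : 0 < m.+1%:R :> R by rewrite ltr0n.
  rewrite /w -exprVn -exprMn lerXn2r ?nnegrE ?mulr_ge0 ?normc_ge0 ?invr_ge0 //.
  rewrite ler_pdivlMr // mulrC.
  apply: le_trans (ler_wpM2r (normc_ge0 _ _) lo) _; rewrite -mulrA ler_piMr //.
  exact: normc_geometric_decay.
have mun i : (mu i < n.+2)%N.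
  rewrite -(ltr_nat R); have /andP[lo _] := muP i; apply: le_lt_trans lo _.
  rewrite -!natr1; have := th2 i; nra.
apply: (@le_trans _ _ (\sum_(i <- s) n%:R ^+ 2 * w (mu i))).
  by apply: ler_sum => i _.
have cnt (m : nat) : (count (fun i => mu i == m) s)%:R <= 2 * K.
  (* The midpoint of bin m: [|th i|] is within 1 / (2n) of it, and the sign of [th i] decides
     whether [b - h] or [b + h] is the centre of the covering interval. *)
  pose h : R := (m%:R + 1 / 2) / n%:R.
  pose p c := fun i => near_int (2 * n%:R)^-1 (c - alpha i).
  apply: (@le_trans _ _ (count (predU (p (b - h)) (p (b + h))) s)%:R).
    rewrite ler_nat; apply: sub_count => i /eqP mi.
    have := muP i; rewrite mi => /andP[lo up].
    have key : `| `|th i| - h | <= (2 * n%:R)^-1.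
      rewrite -(ler_pM2l nR) -[X in X * `|_ - _|](ger0_norm (ltW nR)) -normrM.
      rewrite /h mulrBr [n%:R * (_ / _)]mulrC divfK ?gt_eqF //.
      have -> : n%:R * (2 * n%:R)^-1 = 1 / 2 :> R by field; rewrite gt_eqF.
      rewrite ler_norml; move: up; rewrite -natr1 => up; apply/andP; split; lra.
    apply/orP; rewrite /p; have [t0|t0] := ger0P (th i).
      left; apply/asboolP; exists (Num.floor (b - alpha i + 1 / 2)).
      rewrite (_ : _ - _ = `|th i| - h) // ger0_norm // /th; ring.
    right; apply/asboolP; exists (Num.floor (b - alpha i + 1 / 2)).
    rewrite -normrN (_ : - _ = `|th i| - h) // ltr0_norm // /th; ring.
  have -> : 2 * K = K + K by rewrite mulr2n mulrDl mul1r.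
  apply: le_trans (lerD (hK (b - h)) (hK (b + h))).
  by rewrite -natrD ler_nat -count_predUI leq_addr.
have K0 : 0 <= K by apply: le_trans (hK 0); rewrite ler0n.
have E i : w (mu i) = \sum_(0 <= m < n.+2) (mu i == m)%:R * w m.
  rewrite (bigD1_seq (mu i)) ?mem_index_iota ?mun ?iota_uniq //= eqxx mul1r.
  by rewrite big1 ?addr0 // => m mi; rewrite eq_sym (negbTE mi) mul0r.
rewrite -mulr_sumr; under eq_bigr do rewrite E.
rewrite exchange_big /=.
(* Two intervals per bin give 2K; the weights add up to at most 6, namely 4 from bin 0 and at most 2
   from the inverse squares. *)
have -> : 12 * n%:R ^+ 2 * K = n%:R ^+ 2 * (2 * K * 6) by ring.
rewrite ler_pM2l ?exprn_gt0 //.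
apply: (@le_trans _ _ (\sum_(0 <= m < n.+2) 2 * K * w m)).
  apply: ler_sum => m _; rewrite -mulr_suml ler_wpM2r //.
  apply: le_trans (cnt m); rewrite -sum1_count natr_sum [leRHS]big_mkcond /=.
  by rewrite ler_sum // => i _; case: eqP.
rewrite -mulr_sumr ler_wpM2l ?mulr_ge0 // big_ltn //=.
have := sum_inv_sqr_le R n; have : 0 <= (n.+1%:R : R)^-1 by rewrite invr_ge0.
have -> : \sum_(1 <= m < n.+2) w m = \sum_(1 <= m < n.+2) (m%:R ^+ 2)^-1.
  by apply: eq_big_nat => -[].
move: (n.+1%:R^-1) (\sum_(1 <= m < n.+2) _) => x y; lra.
Qed.

(** [K] bounds the number of points, modulo 1, in any closed interval of length 1 / n, so the points
    may cluster. [large_sieve] is applied with B = 12 n^2 K, and its division by n leaves 12 n K. *)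
Lemma large_sieve_spacing (R : realType) (I : Type) (s : seq I) (alpha : I -> R)
    (a : nat -> R[i]) (n : nat) (K : R) :
  (0 < n)%N -> 0 < K ->
  (forall b, (count (fun i => near_int (2 * n%:R)^-1 (b - alpha i)) s)%:R <= K) ->
  \sum_(i <- s) cnorm (\sum_(1 <= k < n.+1) a k * e (k%:R * alpha i)) ^+ 2
    <= 12 * n%:R * K * \sum_(1 <= k < n.+1) cnorm (a k) ^+ 2.
Proof.
move=> n0 K0 hK; have nR : 0 < n%:R :> R by rewrite ltr0n.
have B0 : 0 < ((12 * n%:R ^+ 2 * K)%:C)%C :> R[i].
  by rewrite ltcR mulr_gt0 // mulr_gt0 // exprn_gt0.
have := @large_sieve R[i] I s (fun i => e (alpha i)) a n _ n0 B0 (fun i => norm_e _ _).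
have step (i : I) :
    \sum_(j <- s) `|\sum_(k < n.*2) (e (alpha i) * (e (alpha j))^*) ^+ k| ^+ 2
    <= ((12 * n%:R ^+ 2 * K)%:C)%C.
  apply: le_trans _ (_ : (_%:C)%C <= _); last first.
    by rewrite lecR; exact: sum_geometric_le n0 hK (alpha i).
  rewrite rmorph_sum le_eqVlt; apply/orP; left; apply/eqP/eq_bigr => j _.
  by rewrite rmorphXn /= -norm_normc eD eN.
move=> /(_ step).
have -> : ((12 * n%:R ^+ 2 * K)%:C)%C / n%:R = ((12 * n%:R * K)%:C)%C :> R[i].
  apply: (canLR (mulfK _)); first by rewrite pnatr_eq0 -lt0n.
  by rewrite -(rmorph_nat (real_complex R)) -rmorphM /=; congr (_%:C)%C; ring.
under eq_bigr do under eq_bigr do rewrite -eMn.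
under eq_bigr do rewrite norm_normc -rmorphXn.
under [X in _ * X]eq_bigr do rewrite norm_normc -rmorphXn.
by rewrite -!rmorph_sum -rmorphM lecR.
Qed.

(** * The divisor bound *)

(** A divisor d is p^j t with p^j = gcd(d, p^i) and t = d / p^j. Here t divides (p^i / p^j) m and is
    coprime to p^i / p^j, hence divides m. *)
Lemma size_divisors_pexp_mul (p i m : nat) : prime p -> (0 < m)%N ->
  (size (divisors (p ^ i * m)) <= i.+1 * size (divisors m))%N.
Proof.
move=> pp m0.
have -> : (i.+1 * size (divisors m))%N
    = size [seq (p ^ j * t)%N | j <- iota 0 i.+1, t <- divisors m].
  by rewrite size_allpairs size_iota.
apply: uniq_leq_size; first exact: divisors_uniq.
move=> d; rewrite -dvdn_divisors ?muln_gt0 ?expn_gt0 ?m0 ?(prime_gt0 pp) // => dpm.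
pose g := gcdn d (p ^ i).
have /(@dvdn_pfactor p g i pp)[j ji gE] : (g %| p ^ i)%N by exact: dvdn_gcdr.
apply/allpairsP; exists (j, d %/ g)%N; split.
- by rewrite mem_iota add0n ltnS.
- rewrite /= -dvdn_divisors //.
  have g0 : (0 < g)%N by rewrite gcdn_gt0 expn_gt0 (prime_gt0 pp) orbT.
  have cop : coprime (d %/ g) (p ^ i %/ g).
    by rewrite /coprime -(eqn_pmul2r g0) muln_gcdl !divnK ?dvdn_gcdl ?dvdn_gcdr // mul1n.
  rewrite -(Gauss_dvdr _ cop) -(dvdn_pmul2r g0) mulnAC !divnK ?dvdn_gcdl ?dvdn_gcdr //.
- by rewrite /= -gE mulnC divnK ?dvdn_gcdl.
Qed.

Lemma powR_natX (R : realType) (p i : nat) (d : R) :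
  ((p ^ i)%:R : R) `^ d = (p%:R `^ d) ^+ i.
Proof. by rewrite natrX -powR_mulrn // -powRrM mulrC powRrM powR_mulrn ?powR_ge0. Qed.

(** A prime power p^i contributes a factor i + 1. If p^d >= 2, then i + 1 <= 2^i <= p^(id) costs
    nothing; only the primes below some [P0] fail this, and each of them costs a factor [C1]. *)
Lemma size_divisors_le (R : realType) (d : R) : 0 < d ->
  exists2 C : R, 0 < C &
    forall n : nat, (0 < n)%N -> (size (divisors n))%:R <= C * n%:R `^ d.
Proof.
move=> d0.
have [P0 hP0] : exists P0 : nat, forall p : nat, (P0 <= p)%N -> 2 <= p%:R `^ d.
  exists (Num.truncn (2 `^ d^-1 : R)).+1 => p hp.
  have : (2 `^ d^-1 : R) <= p%:R.
    apply/ltW/(lt_le_trans (Num.Theory.truncnS_gt _)); by rewrite ler_nat.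
  move=> /(ge0_ler_powR (ltW d0)) h.
  have E : (2 `^ d^-1) `^ d = 2 :> R by rewrite -powRrM mulVf ?gt_eqF // powRr1.
  by rewrite -E h ?nnegrE ?powR_ge0.
pose c : R := 2 `^ d - 1.
have c0 : 0 < c.
  have l2 : 0 < d * ln 2 by rewrite mulr_gt0 // ln_gt0 // ltr1n.
  by rewrite subr_gt0 /powR pnatr_eq0 /= expR_gt1.
(* Chosen so that i + 1 <= C1 (1 + i c), which with Bernoulli's inequality [bern] gives i + 1 <= C1
   2^(id). *)
pose C1 : R := 1 + c^-1.
have C1_ge1 : 1 <= C1 by rewrite lerDl invr_ge0 ltW.
have C1_gt0 : 0 < C1 by exact: lt_le_trans C1_ge1.
have pow_mono (x y : R) i : 0 <= x -> x <= y -> x ^+ i <= y ^+ i.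
  by move=> x0 xy; rewrite lerXn2r ?nnegrE // (le_trans x0).
have bern (i : nat) : 1 + i%:R * c <= (2 `^ d) ^+ i.
  have -> : 2 `^ d = 1 + c by rewrite /c; ring.
  elim: i => [|i IH]; first by rewrite mul0r addr0 expr0.
  rewrite exprS; apply: le_trans (ler_wpM2l _ IH); last by rewrite addr_ge0 // ltW.
  rewrite -natr1; have := ler0n R i; nra.
have small p i : prime p -> i.+1%:R <= C1 * (p%:R `^ d) ^+ i.
  move=> pp; have p2 : (2 `^ d) ^+ i <= (p%:R `^ d) ^+ i :> R.
    apply: pow_mono; first exact: powR_ge0.
    by rewrite ge0_ler_powR ?nnegrE ?(ltW d0) // ler_nat prime_gt1.
  apply: le_trans (ler_wpM2l (ltW C1_gt0) p2).
  apply: le_trans (ler_wpM2l (ltW C1_gt0) (bern i)).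
  rewrite -subr_ge0 -natr1.
  have -> : C1 * (1 + i%:R * c) - (i%:R + 1) = i%:R * c + c^-1.
    by rewrite /C1; field; rewrite gt_eqF.
  by rewrite addr_ge0 ?invr_ge0 ?mulr_ge0 // ltW.
have large p i : (P0 <= p)%N -> i.+1%:R <= (p%:R `^ d) ^+ i.
  move=> /hP0 hp; apply: (@le_trans _ _ (2 ^+ i)); last exact: pow_mono.
  by rewrite -natrX ler_nat ltn_expl.
have C1X k : 0 <= C1 ^+ k by rewrite exprn_ge0 // ltW.
(* Induction on a strict bound k for the prime factors of n, splitting off the full power of the
   prime k. The exponent [minn k P0] stops growing once k reaches [P0], as larger primes cost no
   constant. *)
have main k n : (0 < n)%N -> (forall p, prime p -> (p %| n)%N -> (p < k)%N) ->
    (size (divisors n))%:R <= C1 ^+ minn k P0 * n%:R `^ d.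
  elim: k n => [|k IH] n n0 hn.
    have -> : n = 1%N.
      apply/eqP; rewrite eqn_leq n0 andbT leqNgt; apply/negP => n1.
      by have := hn _ (pdiv_prime n1) (pdiv_dvd n).
    by rewrite min0n expr0 mul1r powR1.
  have mono : C1 ^+ minn k P0 <= C1 ^+ minn k.+1 P0.
    by rewrite ler_weXn2l // leq_min geq_minr andbT (leq_trans (geq_minl _ _)).
  have [pk|npk] := boolP (prime k); last first.
    apply: le_trans (IH n n0 _) _.
      move=> p pp pn; have := hn p pp pn; rewrite ltnS leq_eqVlt => /orP[/eqP pk|//].
      by rewrite -pk pp in npk.
    by rewrite ler_wpM2r ?powR_ge0.
  have [m km nE] := pfactor_coprime pk n0.
  set i := logn k n in nE.
  have m0 : (0 < m)%N by move: n0; rewrite nE muln_gt0 => /andP[].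
  have hm : (size (divisors m))%:R <= C1 ^+ minn k P0 * m%:R `^ d.
    apply: IH => // p pp pm; have := hn p pp; rewrite nE dvdn_mulr // => /(_ isT).
    rewrite ltnS leq_eqVlt => /orP[/eqP pkE|//].
    by move: km; rewrite -pkE prime_coprime // pm.
  rewrite nE mulnC; apply: le_trans (_ : (i.+1 * size (divisors m))%:R <= _).
    by rewrite ler_nat size_divisors_pexp_mul.
  rewrite !natrM powRM // powR_natX.
  apply: (@le_trans _ _ (i.+1%:R * (C1 ^+ minn k P0 * m%:R `^ d))).
    by rewrite ler_wpM2l.
  rewrite !mulrA; apply: ler_wpM2r; first exact: powR_ge0.
  have [Pk|kP] := leqP P0 k.
    rewrite (minn_idPr (leqW Pk)) mulrC ler_wpM2l //; exact: large.
  rewrite (minn_idPl kP) mulrC exprSr -mulrA.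
  by rewrite ler_wpM2l //; exact: small.
exists (C1 ^+ P0); first by rewrite exprn_gt0.
move=> n n0; apply: le_trans (main n.+1 n n0 _) _.
  by move=> p _ /(dvdn_leq n0).
by rewrite ler_wpM2r ?powR_ge0 // ler_weXn2l // geq_minr.
Qed.

(** * Dirichlet approximation *)

(** Pigeonhole for the fractional parts of kx, 0 <= k <= T, in T + 1 boxes of length 1 / (T + 1):
    either two of them share a box, or every box is hit, in particular the one just below 1. *)
Lemma dirichlet_approx_mul (R : realType) (x : R) (T : nat) : (0 < T)%N ->
  exists (r : nat) (b : int),
    (0 < r <= T)%N /\ `|r%:R * x - b%:~R| <= T.+1%:R^-1.
Proof.
move=> T0.
have T1 : 0 < T.+1%:R :> R by rewrite ltr0n.
pose fl k : int := Num.floor (k%:R * x).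
pose fr k : R := k%:R * x - (fl k)%:~R.
have fr_itv k : 0 <= fr k < 1.
  have /andP[lo up] := Num.Theory.floor_itv (k%:R * x).
  by rewrite /fr /fl subr_ge0 lo ltrBlDl addrC; move: up; rewrite intrD addrC.
pose v k := Num.truncn (T.+1%:R * fr k).
have v_itv k : (v k)%:R <= T.+1%:R * fr k < (v k).+1%:R.
  by apply: Num.Theory.truncn_itv; rewrite mulr_ge0 //; case/andP: (fr_itv k).
have vT k : (v k < T.+1)%N.
  rewrite -(ltr_nat R); have /andP[lo _] := v_itv k; apply: le_lt_trans lo _.
  by rewrite -[ltRHS]mulr1 ltr_pM2l //; case/andP: (fr_itv k).
pose f (k : 'I_T.+1) := Ordinal (vT k).
have [/injectiveP finj|/injectivePn[i [j ij fij]]] := boolP (injectiveb f).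
  (* The k in the last box has kx at most 1 / (T + 1) below the integer [fl k + 1]. It is nonzero,
     since k = 0 falls into the first box and T > 0. *)
  have [g _ gK] := injF_bij finj.
  pose k := g ord_max; have vk : v k = T by rewrite -[v k]/(val (f k)) gK.
  have k0 : (0 < k)%N.
    rewrite lt0n; apply/eqP => k0; have := v_itv k.
    rewrite vk k0 /fr /fl mul0r floor0 subr0 mulr0 => /andP[+ _].
    by rewrite lern0; lia.
  exists k, (fl k + 1); split; first by rewrite k0 -ltnS ltn_ord.
  have /andP[lo _] := v_itv k; have /andP[_ up] := fr_itv k.
  rewrite vk in lo; rewrite -(ler_pM2l T1) mulfV ?gt_eqF //.
  rewrite intrD opprD addrA -/(fr k) ler0_norm; last by lra.
  by move: lo; rewrite -natr1; nra.
wlog ij' : i j ij fij / (i < j)%N.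
  move=> wl; have := ij; rewrite -val_eqE neq_ltn => /orP[|] lt; first exact: (wl i j).
  by apply: (wl j i) => //; rewrite eq_sym.
exists (j - i)%N, (fl j - fl i); split.
  by rewrite subn_gt0 ij' /= (leq_trans (leq_subr _ _)) // -ltnS ltn_ord.
rewrite natrB 1?ltnW // intrB.
have vij : v i = v j by move/(congr1 val): fij.
have := v_itv i; have := v_itv j; rewrite vij -[(v j).+1%:R]natr1.
move=> /andP[lj uj] /andP[li ui].
rewrite -(ler_pM2l T1) mulfV ?gt_eqF // -{1}(ger0_norm (ltW T1)) -normrM.
have -> : T.+1%:R * ((j%:R - i%:R) * x - ((fl j)%:~R - (fl i)%:~R))
  = T.+1%:R * fr j - T.+1%:R * fr i by rewrite /fr; ring.
by rewrite ler_norml; apply/andP; split; lra.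
Qed.

(** Cancelling g = gcd(r, b) makes the fraction reduced and only improves the estimate, because |r x
    - b| is g times the same quantity for the reduced pair. *)
Lemma dirichlet_approx (R : realType) (x : R) (T : nat) : (0 < T)%N ->
  exists (r : nat) (b : int), [/\ (0 < r <= T)%N, coprimez r%:Z b
    & `|x - b%:~R / r%:R| <= (r%:R * T.+1%:R)^-1].
Proof.
move=> T0; have [r [b [/andP[r0 rT] hb]]] := dirichlet_approx_mul R x T T0.
have T1 : 0 < T.+1%:R :> R by rewrite ltr0n.
pose g := gcdn r `|b|%N.
have g0 : (0 < g)%N by rewrite gcdn_gt0 r0.
have gr : (g %| r)%N by exact: dvdn_gcdl.
have gb : (g%:Z %| b)%Z by rewrite dvdzE /= dvdn_gcdr.
pose r' := (r %/ g)%N; pose b' := (b %/ g%:Z)%Z.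
have rE : r = (r' * g)%N by rewrite divnK.
have bE : b = b' * g%:Z by rewrite divzK.
have r'0 : (0 < r')%N by rewrite divn_gt0 // dvdn_leq.
exists r', b'; split.
- by rewrite r'0 (leq_trans (leq_div _ _)).
- rewrite coprimezE /= /coprime -(eqn_pmul2r g0) mul1n muln_gcdl.
  by rewrite -rE -[X in (_ * X)%N]/(`|g%:Z|%N) -abszM -bE.
have r'R : 0 < r'%:R :> R by rewrite ltr0n.
rewrite invfM -(ler_pM2l r'R) mulrA mulfV ?gt_eqF // mul1r.
rewrite -{1}(ger0_norm (ltW r'R)) -normrM mulrBr mulrCA mulfV ?gt_eqF // mulr1.
apply: le_trans hb; rewrite rE bE natrM rmorphM /= mulrAC -mulrBl normrM.
by rewrite ler_peMr // ger0_norm // ler1n.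
Qed.

(** * Counting elements of S in short intervals and residue classes *)

Lemma count_predU_le (T : Type) (a b : pred T) (s : seq T) :
  (count (predU a b) s <= count a s + count b s)%N.
Proof. by rewrite -count_predUI leq_addr. Qed.

Lemma card_fset_count (T : choiceType) (A : {fset T}) (P : pred T) :
  #|` [fset x in A | P x] | = count P A.
Proof.
rewrite -size_filter; apply/perm_size/uniq_perm; first exact: fset_uniq.
  by rewrite filter_uniq ?fset_uniq.
by move=> x; rewrite !inE mem_filter andbC.
Qed.

(** gcd(m, r) is one of the common divisors of m and r, so it is at most their sum. After exchanging
    the sums, each t dividing r contributes t floor(y / t) <= y. *)
Lemma sum_gcdn_le (r y : nat) : (0 < r)%N ->
  (\sum_(1 <= m < y.+1) gcdn m r <= y * size (divisors r))%N.
Proof.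
move=> r0.
apply: (@leq_trans (\sum_(1 <= m < y.+1) \sum_(t <- divisors r) (t %| m) * t)%N).
  apply: leq_sum => m _.
  rewrite (bigD1_seq (gcdn m r)) ?divisors_uniq //=.
    by rewrite dvdn_gcdl mul1n leq_addr.
  by rewrite -dvdn_divisors // dvdn_gcdr.
rewrite exchange_big /=.
have -> : (y * size (divisors r) = \sum_(t <- divisors r) y)%N.
  by rewrite big_const_seq count_predT iter_addn_0.
rewrite big_seq_cond [leqRHS]big_seq_cond.
apply: leq_sum => t /andP[]; rewrite -dvdn_divisors // => tr _.
by rewrite -big_distrl /= -divn_count_dvd leq_trunc_div.
Qed.

(** With t = gcd(m, r), t divides b0 q and is coprime to b0, so it divides q. Dividing the relation
    by t leaves a congruence modulo r / t, solved for q / t by inverting b0. *)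
Lemma fiber_congruence (r : nat) (b0 m : int) : (0 < r)%N -> coprimez r%:Z b0 ->
  exists l : int, coprimez (r %/ gcdn `|m|%N r)%N%:Z l /\
    forall q : nat, (r%:Z %| m + b0 * q%:Z)%Z ->
      (gcdn `|m|%N r %| q)%N /\
      ((q %/ gcdn `|m|%N r)%N%:Z == l %[mod (r %/ gcdn `|m|%N r)%N%:Z])%Z.
Proof.
move=> r0 cop; set t := gcdn _ _; set k := (r %/ t)%N.
have t0 : (0 < t)%N by rewrite gcdn_gt0 r0 orbT.
have rE : r = (k * t)%N by rewrite divnK // dvdn_gcdr.
pose m' := (m %/ t%:Z)%Z.
have mE : m = m' * t%:Z by rewrite divzK // dvdzE /= dvdn_gcdl.
have copm : coprimez k%:Z m'.
  rewrite coprimezE /= coprime_sym /coprime -(eqn_pmul2r t0) mul1n muln_gcdl -rE.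
  by rewrite -[X in (_ * X)%N]/(`|t%:Z|%N) -abszM -mE.
have /coprimezP[[u v] /= uv] := cop.
have copv : coprimez k%:Z v.
  apply/coprimezP; exists (u * t%:Z, b0) => /=.
  by rewrite -uv rE PoszM; ring.
have copt : coprimez t%:Z b0.
  by apply/coprimezP; exists (u * k%:Z, v) => /=; rewrite -uv rE PoszM; ring.
(* The Bezout coefficient v inverts b0 modulo r, hence modulo k; both m' and v are coprime to k. *)
exists (- (m' * v)); split; first by rewrite coprimezN coprimezMr copm copv.
move=> q hq.
have tq : (t %| q)%N.
  rewrite -[(_ %| _)%N]/(t%:Z %| q%:Z)%Z -(Gauss_dvdzr _ copt).
  rewrite -[b0 * _](addKr m) addrC rpredB ?mE ?dvdz_mull // -mE.
  by apply: dvdz_trans hq; rewrite rE PoszM dvdz_mull.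
split=> //; set q' := (q %/ t)%N; have qE : q = (q' * t)%N by rewrite divnK.
have kd : (k%:Z %| m' + b0 * q'%:Z)%Z.
  rewrite -(@dvdz_mul2r t%:Z); last by rewrite eqz_nat -lt0n.
  by move: hq; rewrite {1}rE {1}mE qE !PoszM mulrDl mulrA.
rewrite eqz_mod_dvd opprK.
have -> : q'%:Z + m' * v = v * (m' + b0 * q'%:Z) + q'%:Z * u * t%:Z * k%:Z.
  by rewrite -[q'%:Z in LHS]mulr1 -uv rE PoszM; ring.
by rewrite rpredD ?dvdz_mull.
Qed.

(** Frees the window from the range of y in [maxcount]: [dilated S t] lies in (M/t, (M+Q)/t], so a
    window starting further left catches no more than the one at M/t, and one starting further right
    is empty. *)
Lemma count_ap_le_maxcount (R : realType) (M Q : R) (S : {fset nat}) (t : nat)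
    (u : R) (k : nat) (l : int) (y : R) :
  (0 < t)%N -> 0 <= Q -> (forall q : nat, q \in S -> M < q%:R <= M + Q) ->
  (count_ap S t u k l y)%:R <= maxcount M Q S t u k l.
Proof.
move=> t0 Q0 hS.
have tR : 0 < t%:R :> R by rewrite ltr0n.
have MQ : M / t%:R <= (M + Q) / t%:R by rewrite ler_pM2r ?invr_gt0 // lerDl.
have dS q : q \in dilated S t -> M / t%:R < q%:R <= (M + Q) / t%:R.
  rewrite in_dilated // => /hS; rewrite natrM mulrC.
  by rewrite ltr_pdivrMr // ler_pdivlMr.
have [ylo|ylo] := ltP y (M / t%:R).
  apply: le_trans _ (@maxcount_ub R M Q S t u k l (M / t%:R) _); last by rewrite lexx.
  rewrite ler_nat; apply: fsubset_leq_card; apply/fsubsetP => q.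
  rewrite !inE => /and3P[qd /andP[yq qy] ->]; rewrite qd andbT /=.
  have /andP[-> _] := dS q qd; rewrite (le_trans qy) // lerD2r ltW //.
have [yhi|yhi] := leP y ((M + Q) / t%:R).
  by apply: maxcount_ub; rewrite ylo yhi.
apply: le_trans _ (@maxcount_ub R M Q S t u k l (M / t%:R) _); last by rewrite lexx.
rewrite ler_nat; apply: fsubset_leq_card; apply/fsubsetP => q.
rewrite !inE => /and3P[qd /andP[yq qy] _].
have /andP[_ h] := dS q qd; have := lt_trans yhi yq; lra.
Qed.

(** Half-open windows of length u starting at c + iu, -3 <= i <= 1, cover the closed interval of
    length 4u; the fifth one is there for the left endpoint c - 2u. *)
Lemma count_window (R : realType) (M Q : R) (S : {fset nat}) (t : nat)
    (u : R) (k : nat) (l : int) (c : R) :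
  (0 < t)%N -> 0 < u -> 0 <= Q -> (forall q : nat, q \in S -> M < q%:R <= M + Q) ->
  (count (fun q : nat => (`|q%:R - c| <= 2 * u) && (q%:Z == l %[mod k%:Z])%Z)
         (dilated S t))%:R <= 5 * maxcount M Q S t u k l.
Proof.
move=> t0 u0 Q0 hS.
pose p (i : R) := fun q : nat =>
  (c + i * u < q%:R <= c + i * u + u) && (q%:Z == l %[mod k%:Z])%Z.
have hp i : (count (p i) (dilated S t))%:R <= maxcount M Q S t u k l.
  apply: le_trans (count_ap_le_maxcount R M Q S t u k l (c + i * u) t0 Q0 hS).
  by rewrite /count_ap card_fset_count.
pose p5 := predU (p (-3)) (predU (p (-2)) (predU (p (-1)) (predU (p 0) (p 1)))).
apply: (@le_trans _ _ (count p5 (dilated S t))%:R).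
  rewrite ler_nat; apply: sub_count => q /andP[]; rewrite ler_norml => /andP[lo up] cong.
  rewrite /= /p cong !andbT.
  have [h0|h0] := leP q%:R (c - 2 * u); first by apply/orP; left; apply/andP; split; lra.
  have [h1|h1] := leP q%:R (c - u); first by apply/or3P/Or32; apply/andP; split; lra.
  have [h2|h2] := leP q%:R c; first by apply/or4P/Or43; apply/andP; split; lra.
  have [h3|h3] := leP q%:R (c + u); last first.
    by apply/orP; right; apply/or4P/Or44; apply/andP; split; lra.
  by apply/orP; right; apply/or4P/Or43; apply/andP; split; lra.
have step a b x y : (count a (dilated S t))%:R <= x :> R ->
    (count b (dilated S t))%:R <= y :> R ->
    (count (predU a b) (dilated S t))%:R <= x + y :> R.
  move=> hx hy; apply: le_trans (lerD hx hy).
  by rewrite -natrD ler_nat count_predU_le.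
have -> : 5 * maxcount M Q S t u k l = maxcount M Q S t u k l + (maxcount M Q S t u k l
  + (maxcount M Q S t u k l + (maxcount M Q S t u k l + maxcount M Q S t u k l))) by ring.
by rewrite !step.
Qed.

Definition ap_bound {R : realType} (N Q M : R) (S : {fset nat}) (X : R) : Prop :=
  forall (t k : nat) (l : int) (u : R),
    (0 < t)%N -> (0 < k)%N ->
    t%:R <= Num.sqrt N -> k%:R <= Num.sqrt N / t%:R ->
    coprimez k%:Z l ->
    k%:R * Q / Num.sqrt N <= u <= Q / t%:R ->
    maxcount M Q S t u k l
      <= (1 + (#|` dilated S t|%:R / k%:R) / (Q / t%:R) * u) * X.

(* For z = x - b0 / r: there is an integer a with m = a r - b0 q and
   |x - a / q| <= d. *)
Definition fiber {R : realType} (r : nat) (b0 : int) (z d : R) (m : int) (q : nat) :=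
  (r%:Z %| m + b0 * q%:Z)%Z && (`|m%:~R / r%:R - q%:R * z| <= q%:R * d).

Lemma card_dilated_le (S : {fset nat}) (t : nat) : (0 < t)%N ->
  (#|` dilated S t| <= #|` S|)%N.
Proof.
move=> t0; rewrite -(size_map (muln t)); apply: uniq_leq_size.
  rewrite map_inj_uniq ?fset_uniq // => p q /eqP.
  by rewrite eqn_pmul2l // => /eqP.
by move=> _ /mapP[q + ->]; rewrite in_dilated.
Qed.

(** On a fiber, q -> q / t is injective, and its image lies in one reduced residue class modulo k =
    r / t and in one interval of length 4u. The hypothesis then applies with these t, k and u. *)
Lemma count_fiber_le (R : realType) (N Q M X : R) (S : {fset nat}) (r : nat)
    (b0 m : int) (z z' : R) :
  1 <= N -> 1 <= Q -> 0 <= M <= Q ->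
  (forall q : nat, q \in S -> M < q%:R <= M + Q) -> 0 <= X ->
  ap_bound N Q M S X ->
  (0 < r)%N -> r%:R <= Num.sqrt N -> coprimez r%:Z b0 ->
  z' = Num.max `|z| N^-1 -> z' <= (r%:R * Num.sqrt N)^-1 ->
  (count (fiber r b0 z N^-1 m) S)%:R
    <= 5 * X * (1 + #|` S|%:R * (gcdn `|m|%N r)%:R / N / (r%:R * z')).
Proof.
move=> N1 Q1 /andP[M0 MQ] hS X0 hA r0 rN cop z'E z'r.
have [l [copl hl]] := fiber_congruence r b0 m r0 cop.
set t := gcdn _ _ in copl hl *; set k := (r %/ t)%N in copl hl.
have t0 : (0 < t)%N by rewrite gcdn_gt0 r0 orbT.
have rE : r = (k * t)%N by rewrite divnK // dvdn_gcdr.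
have k0 : (0 < k)%N by move: r0; rewrite rE muln_gt0 => /andP[].
have tR : 0 < t%:R :> R by rewrite ltr0n.
have kR : 0 < k%:R :> R by rewrite ltr0n.
have rR : 0 < r%:R :> R by rewrite ltr0n.
have N0 : 0 < N by lra.
have Q0 : 0 < Q by lra.
have sN0 : 0 < Num.sqrt N by rewrite sqrtr_gt0.
have sNN : Num.sqrt N * Num.sqrt N = N by rewrite -expr2 sqr_sqrtr // ltW.
have z'N : N^-1 <= z' by rewrite z'E le_max lexx orbT.
have z'0 : 0 < z' by rewrite (lt_le_trans _ z'N) // invr_gt0.
pose u := Q / (N * z' * t%:R).
have u0 : 0 < u by rewrite divr_gt0 // !mulr_gt0.
(* If |z| >= 1/N, dividing the fiber inequality by z locates q near m / (r z), with error at most 2Q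
   / (N |z|) because q <= 2Q. If |z| < 1/N, then u = Q / t and the whole range of q / t is short
   enough. *)
have [c hc] : exists c : R, forall q : nat, q \in S ->
    `|m%:~R / r%:R - q%:R * z| <= q%:R / N -> `|q%:R / t%:R - c| <= 2 * u.
  have [zN|zN] := leP N^-1 `|z|; last first.
    exists (M / t%:R) => q /hS /andP[Mq qM] _.
    have -> : u = Q / t%:R.
      by rewrite /u z'E max_r 1?ltW // mulfV ?mul1r // gt_eqF.
    rewrite -mulrBl normrM ger0_norm; last by rewrite subr_ge0 ltW.
    rewrite (@ger0_norm _ t%:R^-1) ?invr_ge0 // mulrA ler_pM2r ?invr_gt0 //; lra.
  have z'z : z' = `|z| by rewrite z'E max_l.
  have z0 : z != 0 by rewrite -normr_gt0 -z'z.
  exists (m%:~R / (r%:R * z * t%:R)) => q /hS /andP[Mq qM] hm.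
  have -> : q%:R / t%:R - m%:~R / (r%:R * z * t%:R)
      = - (m%:~R / r%:R - q%:R * z) / (z * t%:R).
    by field; rewrite z0 !gt_eqF.
  rewrite normrM normrN normfV normrM (@ger0_norm _ t%:R) // -z'z.
  have -> : 2 * u = 2 * Q / N / (z' * t%:R) by rewrite /u; field; rewrite !gt_eqF.
  rewrite ler_pM2r ?invr_gt0 ?mulr_gt0 // (le_trans hm) //.
  by rewrite ler_pM2r ?invr_gt0 //; lra.
have cnt : (count (fiber r b0 z N^-1 m) S <=
    count (fun q : nat => (`|q%:R - c| <= 2 * u)%R && (q%:Z == l %[mod k%:Z])%Z)
      (dilated S t))%N.
  rewrite -!size_filter -(size_map (fun q => q %/ t)%N).
  apply: uniq_leq_size.
    rewrite map_inj_in_uniq ?filter_uniq ?fset_uniq // => p q.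
    rewrite !mem_filter => /andP[/andP[/hl[tp _] _] _] /andP[/andP[/hl[tq _] _] _] pq.
    by rewrite -(divnK tp) pq divnK.
  move=> _ /mapP[q + ->]; rewrite !mem_filter => /andP[/andP[/hl[tq cq] hq] qS].
  rewrite cq andbT; apply/andP; split.
    have -> : ((q %/ t)%N%:R : R) = q%:R / t%:R.
      by rewrite -{2}(divnK tq) natrM mulfK // gt_eqF.
    exact: hc.
  by rewrite in_dilated // mulnC divnK.
apply: (@le_trans _ _ (5 * maxcount M Q S t u k l)).
  apply: le_trans (count_window R M Q S t u k l c t0 u0 (ltW Q0) hS).
  by rewrite ler_nat.
rewrite -mulrA ler_pM2l //.
apply: le_trans (hA t k l u t0 k0 _ _ copl _) _.
- by apply: le_trans rN; rewrite ler_nat dvdn_leq // dvdn_gcdr.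
- by rewrite ler_pdivlMr // -natrM -rE.
- apply/andP; split.
    have -> : u = Q / t%:R / (N * z') by rewrite /u; field; rewrite !gt_eqF.
    rewrite ler_pdivlMr ?mulr_gt0 // ler_pdivlMr //.
    have : z' * (r%:R * Num.sqrt N) <= 1 by rewrite -ler_pdivlMr ?mulr_gt0 // div1r.
    rewrite rE natrM => h.
    have -> : k%:R * Q / Num.sqrt N * (N * z') * t%:R
        = Q * (z' * (k%:R * t%:R * Num.sqrt N)).
      by rewrite -[X in X * z']sNN; field; rewrite gt_eqF.
    by rewrite ler_piMr // ltW.
  have -> : u = Q / t%:R / (N * z') by rewrite /u; field; rewrite !gt_eqF.
  rewrite ler_pdivrMr ?mulr_gt0 // ler_peMr ?divr_ge0 ?(ltW Q0) //.
  by rewrite mulrC -ler_pdivrMr // div1r.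
rewrite mulrC ler_wpM2l // lerD2l.
have -> : #|` dilated S t|%:R / k%:R / (Q / t%:R) * u
    = #|` dilated S t|%:R * (t%:R / N / (r%:R * z')).
  by rewrite rE natrM /u; field; rewrite !gt_eqF.
rewrite -!mulrA ler_wpM2r ?ler_nat ?card_dilated_le //.
by rewrite !mulr_ge0 ?invr_ge0 ?mulr_ge0 // ltW.
Qed.

(** * Reduced fractions with denominator in S near a given point *)

(** A fraction b/q is kept as a pair with the denominator first, which turns the double sum of
    [theorem2] into a sum over one list. *)
Definition farey_pairs (S : {fset nat}) : seq (nat * nat) :=
  [seq (q, b) | q <- S, b <- [seq b <- index_iota 1 q.+1 | coprime b q]].

Lemma mem_farey_pairs (S : {fset nat}) (q b : nat) :
  ((q, b) \in farey_pairs S) = [&& q \in S, (0 < b <= q)%N & coprime b q].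
Proof.
apply/allpairsPdep/idP => [[q' [b' [qS + [-> ->]]]]|/and3P[qS bq cop]].
  by rewrite mem_filter mem_index_iota ltnS qS => /andP[-> ->].
by exists q, b; rewrite mem_filter mem_index_iota ltnS cop.
Qed.

Lemma farey_pairs_uniq (S : {fset nat}) : uniq (farey_pairs S).
Proof.
apply: allpairs_uniq_dep => [|q _|[q b] [q' b'] _ _ [-> ->]] //.
- exact: fset_uniq.
- by rewrite filter_uniq ?iota_uniq.
Qed.

Lemma residue_uniq (q b b' : nat) (i i' : int) :
  (0 < b <= q)%N -> (0 < b' <= q)%N ->
  b%:Z + i * q%:Z = b'%:Z + i' * q%:Z -> b = b'.
Proof.
move=> bq bq' E.
have dE : b%:Z - b'%:Z = (i' - i) * q%:Z.
  by apply/eqP; rewrite mulrBl subr_eq addrAC eq_sym subr_eq eq_sym addrC E addrC.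
have q0 : 0 <= q%:Z by [].
have [d1|d1] := lerP 1 (i' - i).
  have := ler_wpM2r q0 d1; rewrite -dE; lia.
have [d2|d2] := lerP (i' - i) (-1).
  have := ler_wpM2r q0 d2; rewrite -dE; lia.
have d0 : i' - i = 0 by clear -d1 d2; lia.
by move: dE; rewrite d0 mul0r; lia.
Qed.

(** Adds the fiber bounds over 1 <= |m| <= y, once for each sign; [sum_gcdn_le] replaces the gcd by
    its average, at most the divisor count of r. *)
Lemma sum_fiber_le (R : realType) (f : int -> R) (A c : R) (r y D : nat) :
  (0 < r)%N -> (size (divisors r) <= D)%N -> 0 <= A -> 0 <= c ->
  (forall m, f m <= A * (1 + c * (gcdn `|m|%N r)%:R)) ->
  \sum_(m <- [seq i%:Z | i <- index_iota 1 y.+1]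
          ++ [seq - i%:Z | i <- index_iota 1 y.+1]) f m
    <= 2 * A * (1 + c * D%:R) * y%:R.
Proof.
move=> r0 hD A0 c0 hf.
have half (h : nat -> int) : (forall i, `|h i|%N = i) ->
    \sum_(1 <= i < y.+1) f (h i) <= A * (1 + c * D%:R) * y%:R.
  move=> hh; apply: (@le_trans _ _ (\sum_(1 <= i < y.+1) A * (1 + c * (gcdn i r)%:R))).
    by apply: ler_sum => i _; apply: le_trans (hf _) _; rewrite hh.
  rewrite -mulr_sumr big_split /= -mulr_sumr sumr_const_nat subn1 /= -natr_sum.
  rewrite -mulrA ler_wpM2l // mulrDl mul1r lerD2l -mulrA ler_wpM2l //.
  rewrite -natrM ler_nat mulnC; apply: leq_trans (sum_gcdn_le r y r0) _.
  by rewrite leq_mul2l hD orbT.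
rewrite big_cat !big_map /=.
have -> : 2 * A * (1 + c * D%:R) * y%:R
  = A * (1 + c * D%:R) * y%:R + A * (1 + c * D%:R) * y%:R by ring.
by rewrite lerD // half // => i; rewrite ?abszN.
Qed.

(** The leading 1 accounts for the fraction equal to the Dirichlet approximation of x; all the
    others have m nonzero and are distributed over the fibers. *)
Lemma count_near_le (R : realType) (N Q M X : R) (S : {fset nat}) (D : nat) :
  1 <= N -> 1 <= Q -> 0 <= M <= Q ->
  (forall q : nat, q \in S -> M < q%:R <= M + Q) -> 0 <= X ->
  ap_bound N Q M S X ->
  (forall r, (0 < r)%N -> r%:R <= Num.sqrt N -> (size (divisors r) <= D)%N) ->
  forall x : R,
  (count (fun p => near_int N^-1 (x - p.2%:R / p.1%:R)) (farey_pairs S))%:R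
    <= 1 + 40 * Q * X * D%:R * (Num.sqrt N + #|` S|%:R) / N.
Proof.
move=> N1 Q1 MQ hS X0 hA hD x.
have /andP[M0 MleQ] := MQ.
have N0 : 0 < N by lra.
have Q0 : 0 < Q by lra.
have sN0 : 0 < Num.sqrt N by rewrite sqrtr_gt0.
have sN1 : 1 <= Num.sqrt N by rewrite -[leLHS]sqrtr1 ler_wsqrtr.
have sNN : Num.sqrt N * Num.sqrt N = N by rewrite -expr2 sqr_sqrtr // ltW.
have [r [b0 [/andP[r0 rT] cop hz]]] :
    exists r b0, [/\ (0 < r <= Num.truncn (Num.sqrt N))%N, coprimez r%:Z b0
      & `|x - b0%:~R / r%:R| <= (r%:R * Num.sqrt N)^-1].
  have T0 : (0 < Num.truncn (Num.sqrt N))%N by rewrite truncn_gt0.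
  have [r [b0 [r0 cop h]]] := dirichlet_approx R x _ T0.
  exists r, b0; split=> //; apply: le_trans h _.
  have rR : 0 < r%:R :> R by rewrite ltr0n; case/andP: r0.
  rewrite lef_pV2 ?posrE ?mulr_gt0 // ler_pM2l // ltW //.
  exact: Num.Theory.truncnS_gt.
have rR : 0 < r%:R :> R by rewrite ltr0n.
have rN : r%:R <= Num.sqrt N by rewrite -truncn_ge_nat // ltW.
have D1 : (1 <= D)%N by apply: leq_trans (hD 1%N _ _).
have D1R : 1 <= D%:R :> R by rewrite ler1n.
pose z := x - b0%:~R / r%:R; pose z' := Num.max `|z| N^-1.
have z'0 : 0 < z' by rewrite lt_max invr_gt0 N0 orbT.
have z'r : z' <= (r%:R * Num.sqrt N)^-1.
  rewrite ge_max hz /= lef_pV2 ?posrE ?mulr_gt0 //.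
  by rewrite -[leRHS]sNN ler_pM2r.
(* The integer translate bringing b/q within 1/N of x, so that [a p] below is the numerator of b/q +
   j. The default 0 is returned only when no such translate exists, which does not happen on [s]. *)
pose j (p : nat * nat) : int :=
  xget 0 [set j : int | `|x - p.2%:R / p.1%:R - j%:~R| <= N^-1]%classic.
pose P (p : nat * nat) := near_int N^-1 (x - p.2%:R / p.1%:R).
pose s := [seq p <- farey_pairs S | P p].
pose a p : int := p.2%:Z + j p * p.1%:Z.
pose m p : int := a p * r%:Z - b0 * p.1%:Z.
have s_uniq : uniq s by rewrite filter_uniq ?farey_pairs_uniq.
have sP p : p \in s -> [/\ p.1 \in S, (0 < p.2 <= p.1)%N, coprimez (a p) p.1%:Z
    & `|(m p)%:~R / r%:R - p.1%:R * z| <= p.1%:R / N].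
  case: p => q b; rewrite mem_filter mem_farey_pairs.
  move=> /andP[/asboolP hj /and3P[qS bq copq]].
  split=> //=.
    rewrite coprimezE /= -[coprime _ _]/(coprimez (a (q, b)) q%:Z) /coprimez.
    by rewrite /a /= gcdzC addrC gcdzMDl gcdzC.
  have q0 : 0 < q%:R :> R by rewrite ltr0n; case/andP: bq => b1; exact: leq_trans.
  have /(_ hj) := @xgetPex _ 0 [set j : int | `|x - b%:R / q%:R - j%:~R| <= N^-1]%classic.
  rewrite -/(j (q, b)) /= => hjj.
  have -> : (m (q, b))%:~R / r%:R - q%:R * z
      = - (q%:R * (x - b%:R / q%:R - (j (q, b))%:~R)).
    rewrite /m /a /z /= rmorphB !rmorphM rmorphD /= rmorphM /=.
    by field; rewrite !gt_eqF.
  by rewrite normrN normrM ger0_norm ?ler0n // ler_pM2l.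
(* From m and q one recovers a, hence b modulo q, hence b itself since 1 <= b <= q. Pairs in [s] can
   therefore be counted through their images under [g]. *)
pose g p := (m p, p.1).
have g_inj : {in s &, injective g}.
  move=> [q b] [q' b'] /sP[_ bq _ _] /sP[_ bq' _ _].
  rewrite /g /m /a /=; move: (j _) (j _) => i i' [+ qq]; subst q'.
  have r0z : r%:Z != 0 by rewrite eqz_nat -lt0n.
  by move=> /addIr /(mulIf r0z) E; congr pair; apply: residue_uniq E.
have m0 p : p \in s -> m p = 0 -> p.1 = r.
  move=> /sP[_ _ copq _] /eqP; rewrite subr_eq0 => /eqP E.
  apply/eqP; rewrite eqn_dvd; apply/andP; split.
    have : (p.1%:Z %| a p * r%:Z)%Z by rewrite E dvdz_mull.
    by rewrite Gauss_dvdzr // coprimez_sym.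
  have : (r%:Z %| b0 * p.1%:Z)%Z by rewrite -E dvdz_mull.
  by rewrite Gauss_dvdzr.
(* The range of |m|: the fiber inequality gives |m| / r <= q / N + q |z| <= 2 q z', and q <= M + Q
   <= 2Q. *)
pose y := Num.truncn (4 * r%:R * Q * z').
have y0 : 0 <= 4 * r%:R * Q * z' by rewrite ltW // !mulr_gt0.
have y_le : y%:R <= 4 * r%:R * Q * z'.
  by rewrite truncn_le.
have my p : p \in s -> (`|m p| <= y)%N.
  move=> /sP[/hS /andP[_ qM] _ _ hm].
  rewrite truncn_ge_nat // natr_absz intr_norm.
  have mr : `|(m p)%:~R / r%:R| <= 2 * p.1%:R * z' :> R.
    have := ler_distD (p.1%:R * z) ((m p)%:~R / r%:R) 0.
    rewrite !subr0 => /le_trans; apply.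
    have -> : 2 * p.1%:R * z' = p.1%:R * z' + p.1%:R * z' by ring.
    apply: lerD; first by apply: le_trans hm _; rewrite ler_wpM2l // le_max lexx orbT.
    by rewrite normrM ger0_norm // ler_wpM2l // le_max lexx.
  rewrite normrM normfV (@ger0_norm _ r%:R) // ler_pdivrMr // in mr.
  apply: le_trans mr _.
  have -> : 2 * p.1%:R * z' * r%:R = (p.1%:R * 2) * (r%:R * z') by ring.
  have -> : 4 * r%:R * Q * z' = (4 * Q) * (r%:R * z') by ring.
  rewrite ler_pM2r ?mulr_gt0 //; lra.
pose ms := [seq i%:Z | i <- index_iota 1 y.+1] ++ [seq - i%:Z | i <- index_iota 1 y.+1].
pose TL := [seq (i, q) | i <- ms, q <- [seq q <- S | fiber r b0 z N^-1 i q]].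
(* If m = 0, then a/q and b0/r are equal reduced fractions, so q = r and [g] takes the single value
   (0, r). The pairs with m nonzero are sent injectively into [TL]. *)
have cnt : (count P (farey_pairs S) <= 1 + size TL)%N.
  rewrite -size_filter -/s; clearbody s.
  rewrite -(count_predC (fun p => m p == 0) s) -!size_filter.
  apply: leq_add; rewrite -(size_map g).
    apply: (@uniq_leq_size _ _ [:: (0, r)]).
      rewrite map_inj_in_uniq ?filter_uniq // => p p'; rewrite !mem_filter.
      by move=> /andP[_ ps] /andP[_ ps']; exact: g_inj.
    move=> _ /mapP[p + ->]; rewrite mem_filter inE => /andP[/eqP mp ps].
    by rewrite /g mp (m0 p).
  apply: uniq_leq_size.
    rewrite map_inj_in_uniq ?filter_uniq // => p p'; rewrite !mem_filter.
    by move=> /andP[_ ps] /andP[_ ps']; exact: g_inj.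
  move=> _ /mapP[p + ->]; rewrite mem_filter /= => /andP[mp ps].
  have [pS _ _ hm] := sP p ps.
  apply: allpairs_f_dep; last first.
    rewrite mem_filter pS andbT /fiber hm andbT /m subrK.
    exact: dvdz_mull.
  have := my p ps; rewrite /ms mem_cat.
  case: (m p) mp => [i|i] i0 hi.
    by rewrite map_f // mem_index_iota ltnS hi lt0n andbT.
  rewrite NegzE; apply/orP; right.
  by apply/mapP; exists i.+1 => //; rewrite mem_index_iota ltnS.
rewrite -/P; apply: (@le_trans _ _ (1 + size TL)%:R); first by rewrite ler_nat.
rewrite natrD lerD2l size_allpairs_dep sumnE big_map.
under eq_bigr do rewrite size_filter.
rewrite natr_sum.
have c0 : 0 <= #|` S|%:R / (N * (r%:R * z')) :> R.
  by rewrite divr_ge0 // ltW // !mulr_gt0.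
have A0 : 0 <= 5 * X by rewrite mulr_ge0.
have fib i : (count (fiber r b0 z N^-1 i) S)%:R
    <= 5 * X * (1 + #|` S|%:R / (N * (r%:R * z')) * (gcdn `|i|%N r)%:R).
  have := count_fiber_le R N Q M X S r b0 i z z' N1 Q1 MQ hS X0 hA r0 rN cop erefl z'r.
  move=> /le_trans; apply; rewrite ler_wpM2l // lerD2l.
  by rewrite le_eqVlt; apply/orP; left; apply/eqP; field; rewrite !gt_eqF.
apply: le_trans (sum_fiber_le R _ _ _ r y D r0 (hD r r0 rN) A0 c0 fib) _.
have c1 : 0 <= 1 + #|` S|%:R / (N * (r%:R * z')) * D%:R by rewrite addr_ge0 // mulr_ge0.
apply: le_trans (ler_wpM2l _ y_le) _; first by rewrite !mulr_ge0.
(* The constant 40 is 2 * 5 * 4: two signs of m, five windows, and the factor 4 in [y]. The factor r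
   z' from [y] cancels the denominator of the gcd term. *)
have -> : 2 * (5 * X) * (1 + #|` S|%:R / (N * (r%:R * z')) * D%:R) * (4 * r%:R * Q * z')
    = 40 * Q * X * (r%:R * z' + D%:R * #|` S|%:R / N).
  by field; rewrite !gt_eqF.
have -> : 40 * Q * X * D%:R * (Num.sqrt N + #|` S|%:R) / N
    = 40 * Q * X * (D%:R * (Num.sqrt N / N) + D%:R * #|` S|%:R / N).
  by field; rewrite gt_eqF.
apply: ler_wpM2l; first by rewrite mulr_ge0 // mulr_ge0 // ltW.
(* [z'r] says that r z' <= 1 / sqrt N; the factor [D] is then inserted using D >= 1. *)
rewrite lerD2r; have rz' : r%:R * z' <= Num.sqrt N / N.
  have -> : Num.sqrt N / N = (Num.sqrt N)^-1.
    by rewrite -[X in _ / X]sNN; field; rewrite gt_eqF.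
  by rewrite mulrC -ler_pdivlMr // -invfM mulrC.
by apply: le_trans rz' _; rewrite ler_peMl // divr_ge0 // ltW.
Qed.

(** * Combination of the large sieve with the count of nearby fractions *)

Theorem theorem2 (R : realType) (eps : R) (heps : 0 < eps) :
  exists2 c2 : R, 0 < c2 &
    forall (N Q M : R) (a : nat -> R[i]) (S : {fset nat}) (X : R),
      1 <= N -> 1 <= Q -> 0 <= M <= Q ->
      (forall q : nat, q \in S -> (0 < q)%N /\ M < q%:R <= M + Q) ->
      1 <= X ->
      (forall (t k : nat) (l : int) (u : R),
          (0 < t)%N -> (0 < k)%N ->
          t%:R <= Num.sqrt N -> k%:R <= Num.sqrt N / t%:R ->
          coprimez k%:Z l ->
          k%:R * Q / Num.sqrt N <= u <= Q / t%:R ->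
          maxcount M Q S t u k l
            <= (1 + (#|` dilated S t|%:R / k%:R) / (Q / t%:R) * u) * X) ->
      \sum_(q <- S) \sum_(1 <= b < q.+1 | coprime b q)
          cnorm (expsum N a (b%:R / q%:R)) ^+ 2
        <= c2 * (N + Q * X * N `^ eps * (Num.sqrt N + #|` S|%:R)) * sqnorm N a.
Proof.
(* The divisor bound is only applied to r <= sqrt N, where r^(2 eps) <= N^eps. *)
have eps2 : 0 < 2 * eps by rewrite mulr_gt0.
have [C C0 hC] := size_divisors_le R _ eps2.
(* 12 comes from [large_sieve_spacing], 40 from [count_near_le], and C is the constant of the
   divisor bound at exponent 2 eps. *)
exists (12 * (1 + 40 * C)); first by rewrite mulr_gt0 // addr_gt0 // mulr_gt0.
move=> N Q M a S X N1 Q1 MQ hS X1 hA.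
have N0 : 0 < N by lra.
have sN0 : 0 < Num.sqrt N by rewrite sqrtr_gt0.
have CN0 : 0 <= C * N `^ eps by rewrite mulr_ge0 ?powR_ge0 ?(ltW C0).
pose D := Num.truncn (C * N `^ eps).
have D_le : D%:R <= C * N `^ eps by rewrite truncn_le.
have hD r : (0 < r)%N -> r%:R <= Num.sqrt N -> (size (divisors r) <= D)%N.
  move=> r0 rN; rewrite truncn_ge_nat //; apply: le_trans (hC r r0) _.
  rewrite ler_wpM2l ?(ltW C0) // powRrM powR_mulrn //.
  apply: ge0_ler_powR; rewrite ?nnegrE ?exprn_ge0 ?(ltW heps) ?(ltW N0) //.
  by rewrite -[leRHS]sqr_sqrtr ?(ltW N0) // lerXn2r ?nnegrE // ltW.
pose n := Num.truncn N.
have n0 : (0 < n)%N by rewrite truncn_gt0.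
have nN : n%:R <= N by rewrite truncn_le ltW.
(* N < n + 1 <= 2n. Hence the radius 1 / (2n) required by the large sieve is at most the radius 1 /
   N for which fractions were counted. *)
have Nn : N <= 2 * n%:R.
  apply: ltW (lt_le_trans (Num.Theory.truncnS_gt N) _).
  by rewrite -natrM ler_nat mul2n -addnn -addn1 leq_add2l.
pose W := Q * X * (Num.sqrt N + #|` S|%:R).
have W0 : 0 <= W by rewrite !mulr_ge0 ?addr_ge0 //; lra.
pose K := 1 + 40 * Q * X * D%:R * (Num.sqrt N + #|` S|%:R) / N.
have KE : K = 1 + 40 * D%:R * W / N by rewrite /K /W; congr (_ + _ / _); ring.
have K0 : 0 < K.
  have DW : 0 <= 40 * D%:R * W by apply: mulr_ge0 => //; exact: mulr_ge0.
  by rewrite KE; apply: ltr_pwDl; rewrite ?divr_ge0 // ltW.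
have hK (x : R) : (count (fun p => near_int (2 * n%:R)^-1 (x - p.2%:R / p.1%:R))
    (farey_pairs S))%:R <= K.
  have X0 : 0 <= X by lra.
  have hS' q : q \in S -> M < q%:R <= M + Q by case/hS.
  have h := count_near_le R N Q M X S D N1 Q1 MQ hS' X0 hA hD x.
  apply: le_trans h.
  rewrite ler_nat; apply: sub_count => p /asboolP[j hj]; apply/asboolP; exists j.
  by apply: le_trans hj _; rewrite lef_pV2 ?posrE // mulr_gt0 // ltr0n.
have := large_sieve_spacing R _ _ (fun p : nat * nat => p.2%:R / p.1%:R) a n K n0 K0 hK.
rewrite big_allpairs_dep /=; under eq_bigr do rewrite big_filter.
move=> /le_trans; apply; apply: ler_wpM2r.
  by apply: sumr_ge0 => i _; exact: sqr_ge0.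
apply: (@le_trans _ _ (12 * N * K)).
  by rewrite ler_wpM2r ?(ltW K0) // ler_wpM2l.
have -> : 12 * N * K = 12 * N + 480 * (D%:R * W) by rewrite KE; field; rewrite gt_eqF.
have := ler_wpM2r W0 D_le.
have -> : Q * X * N `^ eps * (Num.sqrt N + #|` S|%:R) = N `^ eps * W by rewrite /W; ring.
have NW : 0 <= N `^ eps * W by rewrite mulr_ge0 ?powR_ge0.
rewrite -[C * _ * W]mulrA; move: (D%:R * W) (N `^ eps * W) NW => x y y_ge0 xy.
(* The right-hand side exceeds 12 N + 480 C y by 12 y + 480 C N, which is nonnegative. *)
have : 0 <= C * N by rewrite ltW // mulr_gt0.
lra.
Qed.
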